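(* Consider an $N$-body system with $N\ge 2$ and suppose the derivatives $\partial V/\partial r_{ij}$ of the potential have equal signs for all $1\le i<j\le N$ (that is, either all of them are everywhere positive or all of them are everywhere negative). Then for every relative equilibrium $(q,p)$ the configuration $q$ is a planar central configuration.
   Context: $N$-body system: masses $m_i>0$, configuration space $\mathcal X=\{q\in\mathbb{R}^{3N}: q_i\ne q_j \text{ for } i\neq j\}$, phase space $M=T^*\mathcal X\simeq\mathcal X\times\mathbb{R}^{3N}$, Hamiltonian $H(q,p)=\sum_i\frac{1}{2m_i}\|p_i\|^2+V(q)$, where $V$ is a smooth function of the mutual distances $r_{ij}=\|q_i-q_j\|$, $1\le i<j\le N$, only. Let $m=\sum_i m_i$, $Q=\frac1m\sum_i m_iq_i$, $P=\sum_i p_i$, $L=\sum_i q_i\times p_i$. Only points with $P=0$ and $Q=0$ are considered. A relative equilibrium (with respect to $SO(3)$) is a point $(q,p)$, not an equilibrium of the Hamiltonian vector field $X_H$, at which $X_H$ coincides with the Hamiltonian vector field of $\langle \lambda,L\rangle$ for some $\lambda\in\mathbb{R}^3$; equivalently $dH=\sum_k\lambda_k\,dL_k$ at $(q,p)$. A central configuration is $q\in\mathcal X$ for which there is $\lambda\in\mathbb{R}$ with $\frac{\partial V}{\partial q_i}=\lambda m_i(q_i-Q)$ for all $i$. It is planar if all $q_i$ lie in a common plane. *)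

(* Defs.v *)
From HB Require Import structures.
From mathcomp Require Import all_boot all_order all_algebra.
From mathcomp Require Import all_classical all_reals all_analysis.
Set Implicit Arguments.
Unset Strict Implicit.
Unset Printing Implicit Defensive.
Import Order.TTheory GRing.Theory Num.Theory.
Import numFieldNormedType.Exports.
Local Open Scope classical_set_scope.
Local Open Scope ring_scope.

(* C^k on an open set: C^(k+1) means differentiable with all directional
   derivatives of class C^k.  For open D the values of f outside D are
   irrelevant. *)
Fixpoint Ck_on (R : realType) (E : normedModType R) (D : set E) (k : nat)
    (f : E -> R) : Prop :=
  if k is k'.+1 then
    (forall x, D x -> differentiable f x) /\ (forall v, Ck_on D k' ('D_v f))
  else forall x, D x -> {for x, continuous f}.

Definition smooth_on (R : realType) (E : normedModType R) (D : set E)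
    (f : E -> R) : Prop := forall k, Ck_on D k f.

(* The library norm `|_| on matrices is the sup norm, hence the explicit
   Euclidean structure. *)
Definition dot (R : realType) (u v : 'rV[R]_3) : R :=
  \sum_(k < 3) u 0 k * v 0 k.

Definition enorm (R : realType) (u : 'rV[R]_3) : R := Num.sqrt (dot u u).

(* Indices in 'I_3 are added modulo 3. *)
Definition cross (R : realType) (u v : 'rV[R]_3) : 'rV[R]_3 :=
  \row_(k < 3) (u 0 (k + 1) * v 0 (k + 2) - u 0 (k + 2) * v 0 (k + 1)).

Definition gradient (R : realType) (a b : nat) (f : 'M[R]_(a, b) -> R)
    (x : 'M[R]_(a, b)) : 'M[R]_(a, b) :=
  \matrix_(i, k) 'D_(delta_mx i k) f x.

(* A point of R^(3N) is an N x 3 matrix whose i-th row is q_i (resp. p_i). *)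
Definition config_space (R : realType) (N : nat) : set 'M[R]_(N, 3) :=
  [set q | forall i j, i != j -> row i q != row j q].

Definition ipair (N : nat) := {ij : 'I_N * 'I_N | (ij.1 < ij.2)%N}.

(* The mutual distances r_ij, i < j, listed in a row vector; r_ij sits in
   column enum_rank ij. *)
Definition distances (R : realType) (N : nat) (q : 'M[R]_(N, 3)) :
    'rV[R]_#|{: ipair N}| :=
  \row_c (let ij := val (enum_val c) in enorm (row ij.1 q - row ij.2 q)).

Definition dist_partial (R : realType) (N : nat)
    (U : 'rV[R]_#|{: ipair N}| -> R) (ij : ipair N)
    (r : 'rV[R]_#|{: ipair N}|) : R :=
  'D_(delta_mx 0 (enum_rank ij)) U r.

(* V = U(r_ij) on the configuration space, where U is smooth on an open set D
   of R^(N(N-1)/2) containing all distance vectors of configurations. *)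
Definition smooth_in_distances (R : realType) (N : nat) (V : 'M[R]_(N, 3) -> R)
    (D : set 'rV[R]_#|{: ipair N}|) (U : 'rV[R]_#|{: ipair N}| -> R) : Prop :=
  [/\ open D,
      forall q, config_space q -> D (distances q),
      smooth_on D U &
      forall q, config_space q -> V q = U (distances q)].

Definition center_of_mass (R : realType) (N : nat) (m : 'I_N -> R)
    (q : 'M[R]_(N, 3)) : 'rV[R]_3 :=
  (\sum_i m i)^-1 *: \sum_i m i *: row i q.

Definition total_momentum (R : realType) (N : nat) (p : 'M[R]_(N, 3)) :
    'rV[R]_3 := \sum_i row i p.

Definition angular_momentum (R : realType) (N : nat)
    (z : 'M[R]_(N, 3) * 'M[R]_(N, 3)) : 'rV[R]_3 :=
  \sum_i cross (row i z.1) (row i z.2).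

Definition hamiltonian (R : realType) (N : nat) (m : 'I_N -> R)
    (V : 'M[R]_(N, 3) -> R) (z : 'M[R]_(N, 3) * 'M[R]_(N, 3)) : R :=
  \sum_i (2 * m i)^-1 * enorm (row i z.2) ^+ 2 + V z.1.

(* X_f = (df/dp, - df/dq). *)
Definition ham_vector_field (R : realType) (N : nat)
    (f : 'M[R]_(N, 3) * 'M[R]_(N, 3) -> R) (z : 'M[R]_(N, 3) * 'M[R]_(N, 3)) :
    'M[R]_(N, 3) * 'M[R]_(N, 3) :=
  (gradient (fun p => f (z.1, p)) z.2, - gradient (fun q => f (q, z.2)) z.1).

Definition relative_equilibrium (R : realType) (N : nat) (m : 'I_N -> R)
    (V : 'M[R]_(N, 3) -> R) (z : 'M[R]_(N, 3) * 'M[R]_(N, 3)) : Prop :=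
  [/\ config_space z.1,
      center_of_mass m z.1 = 0,
      total_momentum z.2 = 0,
      ham_vector_field (hamiltonian m V) z <> 0 &
      exists lambda : 'rV[R]_3,
        ham_vector_field (hamiltonian m V) z =
        ham_vector_field (fun w => dot lambda (angular_momentum w)) z].

Definition central_configuration (R : realType) (N : nat) (m : 'I_N -> R)
    (V : 'M[R]_(N, 3) -> R) (q : 'M[R]_(N, 3)) : Prop :=
  config_space q /\
  exists lambda : R, forall i,
    row i (gradient V q) = (lambda * m i) *: (row i q - center_of_mass m q).

Definition planar (R : realType) (N : nat) (q : 'M[R]_(N, 3)) : Prop :=
  exists (n : 'rV[R]_3) (c : R), n != 0 /\ forall i, dot n (row i q) = c.

(* Main.v *)
(* At a relative equilibrium with angular velocity l, the p-equations read
   p_i = m_i (l x q_i), so the q-equations become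
   dV/dq_i = p_i x l = m_i (|l|^2 q_i - (l . q_i) l), which is orthogonal to l.
   Hence the derivative of V at q along the displacement q_i |-> (l . q_i) l
   vanishes.  By the chain rule this derivative is also the sum over i < j of
   (dV/dr_ij) (l . (q_i - q_j))^2 / r_ij, and as all dV/dr_ij have the same
   sign, l . q_i does not depend on i; since Q = 0 it is 0.  So q lies in the
   plane orthogonal to l and dV/dq_i = m_i |l|^2 q_i.  Finally l <> 0 because
   the point is not an equilibrium. *)
Require Import Defs.
From mathcomp Require Import all_boot all_order all_algebra.
From mathcomp Require Import all_classical all_reals all_analysis.
From mathcomp Require Import ring.
Set Implicit Arguments.
Unset Strict Implicit.
Import Order.TTheory GRing.Theory Num.Theory.
Import numFieldNormedType.Exports.
Local Open Scope classical_set_scope.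
Local Open Scope ring_scope.

(** * Dot and cross products in coordinates *)

Section VectorAlgebra.
Variable R : realType.
Implicit Types u v w : 'rV[R]_3.

Lemma dotC u v : dot u v = dot v u.
Proof. by apply: eq_bigr => k _; rewrite mulrC. Qed.

Lemma dotDr u v w : dot u (v + w) = dot u v + dot u w.
Proof. by rewrite -big_split; apply: eq_bigr => k _; rewrite mxE mulrDr. Qed.

Lemma dotZr a u v : dot u (a *: v) = a * dot u v.
Proof. by rewrite mulr_sumr; apply: eq_bigr => k _; rewrite mxE mulrCA. Qed.

Lemma dotBr u v w : dot u (v - w) = dot u v - dot u w.
Proof. by rewrite -scaleN1r dotDr dotZr mulN1r. Qed.

Lemma dot_sumr (I : finType) u (F : I -> 'rV[R]_3) :
  dot u (\sum_i F i) = \sum_i dot u (F i).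
Proof.
rewrite exchange_big; apply: eq_bigr => k _.
by rewrite summxE mulr_sumr.
Qed.

Lemma dot0l v : dot 0 v = 0.
Proof. by apply: big1 => k _; rewrite mxE mul0r. Qed.

Lemma dot_line (h : R) u v :
  dot (h *: v + u) (h *: v + u) =
  dot u u + h * (2 * dot u v) + h ^+ 2 * dot v v.
Proof.
rewrite dotDr dotZr dotC (dotC _ u) !(dotDr, dotZr) (dotC v u); ring.
Qed.

Lemma dot_ge0 u : 0 <= dot u u.
Proof. by apply: sumr_ge0 => k _; rewrite -expr2 sqr_ge0. Qed.

Lemma dot_eq0 u : (dot u u == 0) = (u == 0).
Proof.
apply/eqP/eqP => [u0|->]; last exact: dot0l.
apply/rowP => k; rewrite mxE; apply/eqP; rewrite -sqrf_eq0 expr2; apply/eqP.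
by apply: (psumr_eq0P _ u0) => // i _; rewrite -expr2 sqr_ge0.
Qed.

Lemma dot_gt0 u : (0 < dot u u) = (u != 0).
Proof. by rewrite lt0r dot_eq0 dot_ge0 andbT. Qed.

Lemma enorm_sqr u : enorm u ^+ 2 = dot u u.
Proof. exact/sqr_sqrtr/dot_ge0. Qed.

Lemma dotE u v : dot u v = u 0 0 * v 0 0 + u 0 1 * v 0 1 + u 0 2 * v 0 2.
Proof.
rewrite /dot !big_ord_recl big_ord0 addr0 addrA.
by congr (_ + _ + _); congr (u 0 _ * v 0 _); apply: val_inj.
Qed.

Lemma crossE u v :
  [/\ cross u v 0 0 = u 0 1 * v 0 2 - u 0 2 * v 0 1,
      cross u v 0 1 = u 0 2 * v 0 0 - u 0 0 * v 0 2 &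
      cross u v 0 2 = u 0 0 * v 0 1 - u 0 1 * v 0 0].
Proof.
by split; rewrite !mxE; congr (u 0 _ * v 0 _ - u 0 _ * v 0 _); apply: val_inj.
Qed.

(** Both sides are the determinant of [u], [v], [w]. This turns l . (q_i x p_i) into a linear form
    in p_i or in q_i. *)
Lemma dot_cross_cyclic u v w : dot u (cross v w) = dot (cross u v) w.
Proof.
by rewrite !dotE; case: (crossE v w) (crossE u v) => -> -> -> [-> -> ->]; ring.
Qed.

Lemma dot_cross_self u v : dot u (cross v u) = 0.
Proof. by rewrite dotE; case: (crossE v u) => -> -> ->; ring. Qed.

(** Vector triple product expansion; the factor [a] makes room for the mass in p_i = m_i (l x
    q_i). *)
Lemma cross_crossl u v a :
  cross (a *: cross u v) u = a *: (dot u u *: v - dot u v *: u).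
Proof.
rewrite !dotE; have [c0 c1 c2] := crossE (a *: cross u v) u.
have [d0 d1 d2] := crossE u v.
have e k : (a *: cross u v) 0 k = a * cross u v 0 k by rewrite mxE.
rewrite !e d0 d1 d2 in c0 c1 c2; apply/rowP => k.
have : [|| k == 0, k == 1 | k == 2] by case: k => [[|[|[|]]]].
by case/or3P => /eqP ->; rewrite ?c0 ?c1 ?c2 !mxE; ring.
Qed.

End VectorAlgebra.

(** * Directional derivatives and the chain rule *)

Section Derivatives.
Variables (R : realType) (E : normedModType R).

(** For nonzero [h] the difference quotient is exactly [a + h * b]. Linear forms, the kinetic energy
    and squared distances all have this shape along lines. *)
Lemma derive_eq_quadratic (f : E -> R) (x v : E) (a b : R) :
  (forall h, f (h *: v + x) = f x + h * a + h ^+ 2 * b) -> 'D_v f x = a.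
Proof.
move=> fE; rewrite /derive; apply/cvg_lim => //.
have ab : (a + h * b @[h --> 0^']) --> a.
  rewrite -[X in _ --> X]addr0 -[X in _ --> _ + X](mul0r b).
  apply: cvgD; first exact: cvg_cst.
  by apply: (@cvgMr_tmp _ _ _ _ id) => A; exact: nbhs_dnbhs.
apply: cvg_trans ab; apply: near_eq_cvg; near=> h.
have h0 : h != 0 by near: h; exact: nbhs_dnbhs_neq.
by rewrite /= fE /GRing.scale /=; field.
Unshelve. all: by end_near. Qed.

Lemma derive_addl (f : E -> R) (c : R) (x v : E) :
  'D_v (fun y => c + f y) x = 'D_v f x.
Proof.
rewrite /derive; set g1 := fun h => h^-1 *: _; set g2 := fun h => h^-1 *: _.
suff -> : g1 = g2 by []; apply/funext => h; rewrite /g1 /g2 /=.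
by rewrite opprD addrACA subrr add0r.
Qed.

Lemma differentiable_sqrt (f : E -> R) (x : E) : differentiable f x ->
  0 < f x -> differentiable (fun y => Num.sqrt (f y)) x.
Proof.
move=> df fx0; apply: (differentiable_comp df).
by apply/derivable1_diffP; have [] := is_derive1_sqrt fx0.
Qed.

Lemma derive_sqrt_comp (f : E -> R) (x v : E) : differentiable f x ->
  0 < f x ->
  'D_v (fun y => Num.sqrt (f y)) x = (2 * Num.sqrt (f x))^-1 * 'D_v f x.
Proof.
move=> df fx0; have [ds vs] := is_derive1_sqrt fx0.
have ds' := ds; move/derivable1_diffP in ds'.
rewrite deriveE; last exact: differentiable_sqrt.
(* Writing the increment ['D_v f x] as a multiple of 1 lets linearity of the differential bring in
   the one-variable derivative of the square root. *)
rewrite (diff_comp df ds') /= -(deriveE v df) -[X in 'd _ _ X]mulr1.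
by rewrite [LHS]linearZ /= -deriveE // vs /GRing.scale /= mulrC.
Qed.

Lemma differentiable_rV (n : nat) (f : E -> 'rV[R]_n) (x : E) :
  (forall c, differentiable (fun y => f y 0 c) x) -> differentiable f x.
Proof.
move=> df.
have -> : f = \sum_(c < n) (fun y => f y 0 c *: 'e_c).
  by apply/funext => y; rewrite fct_sumE -row_sum_delta.
by apply: differentiable_sum => c; exact: differentiableZl.
Qed.

(** The differential of [g] is linear, so it can be evaluated on the expansion of ['D_v f x] in the
    standard basis. *)
Lemma derive_comp_rV (n : nat) (f : E -> 'rV[R]_n) (g : 'rV[R]_n -> R)
    (x v : E) : differentiable f x -> differentiable g (f x) ->
  'D_v (g \o f) x =
  \sum_(c < n) 'D_v (fun y => f y 0 c) x * 'D_('e_c) g (f x).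
Proof.
move=> df dg; rewrite deriveE; last exact: differentiable_comp.
rewrite diff_comp //= -(deriveE v df) derive_mx; last exact: diff_derivable.
rewrite [X in 'd g _ X]row_sum_delta linear_sum; apply: eq_bigr => c _.
by rewrite linearZ /= -deriveE // mxE.
Qed.

End Derivatives.

(** * Hamiltonian vector fields of the energy and of the angular momentum *)

Section NBody.
Variables (R : realType) (N : nat).
Implicit Types (q p v x : 'M[R]_(N, 3)) (i j : 'I_N).

Lemma row_line i h v x : row i (h *: v + x) = h *: row i v + row i x.
Proof. by apply/rowP => k; rewrite !mxE. Qed.

Lemma sum_dot_delta (a : 'I_N -> 'rV[R]_3) i k :
  \sum_j dot (a j) (row j (delta_mx i k)) = a i 0 k.
Proof.
rewrite (bigD1 i) //= big1 => [|j ji]; last first.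
  by apply: big1 => l _; rewrite !mxE (negPf ji) mulr0.
rewrite addr0 /dot (bigD1 k) //= big1 => [|l lk]; last first.
  by rewrite !mxE (negPf lk) andbF mulr0.
by rewrite !mxE !eqxx mulr1 addr0.
Qed.

Lemma gradient_linear (a : 'I_N -> 'rV[R]_3) x :
  gradient (fun y => \sum_i dot (a i) (row i y)) x = \matrix_i a i.
Proof.
apply/matrixP => i k; rewrite !mxE -sum_dot_delta.
apply: (@derive_eq_quadratic _ _ _ _ _ _ 0) => h.
rewrite mulr0 addr0 mulr_sumr -big_split; apply: eq_bigr => j _ /=.
by rewrite row_line dotDr dotZr addrC.
Qed.

(** Here [c] stands for the potential energy, constant while only the momenta vary. *)
Lemma gradient_kinetic (m : 'I_N -> R) (c : R) x : (forall i, m i != 0) ->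
  gradient (fun y => \sum_i (2 * m i)^-1 * enorm (row i y) ^+ 2 + c) x =
  \matrix_i ((m i)^-1 *: row i x).
Proof.
move=> m0; apply/matrixP => i k; rewrite !mxE.
transitivity (\sum_j dot ((m j)^-1 *: row j x) (row j (delta_mx i k))).
  (* The coefficient of [h ^+ 2] is the kinetic energy of the direction itself. *)
  pose b := \sum_j (2 * m j)^-1 * enorm (row j (delta_mx i k)) ^+ 2.
  apply: (@derive_eq_quadratic _ _ _ _ _ _ b) => h.
  rewrite !(addrAC _ c) /b !mulr_sumr; congr (_ + _).
  rewrite -!big_split; apply: eq_bigr => j _ /=; have := m0 j.
  rewrite row_line !enorm_sqr dot_line (dotC (_ *: _)) dotZr.
  by rewrite (dotC (row j _) (row j x)) => mj0; field.
by rewrite sum_dot_delta !mxE.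
Qed.

Lemma dot_angular_momentum (l : 'rV[R]_3) q p :
  dot l (angular_momentum (q, p)) = \sum_i dot (cross l (row i q)) (row i p).
Proof. by rewrite dot_sumr; apply: eq_bigr => i _; rewrite dot_cross_cyclic. Qed.

Lemma dot_angular_momentum_pos (l : 'rV[R]_3) q p :
  dot l (angular_momentum (q, p)) = \sum_i dot (cross (row i p) l) (row i q).
Proof.
rewrite dot_angular_momentum; apply: eq_bigr => i _.
by rewrite dotC dot_cross_cyclic.
Qed.

Lemma ham_vector_field_momentum (l : 'rV[R]_3) q p :
  ham_vector_field (fun w => dot l (angular_momentum w)) (q, p) =
  (\matrix_i cross l (row i q), - \matrix_i cross (row i p) l).
Proof.
rewrite /ham_vector_field /=; under [X in gradient X p]funext do
  rewrite dot_angular_momentum.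
under [X in gradient X q]funext do rewrite dot_angular_momentum_pos.
by rewrite !gradient_linear.
Qed.

Lemma ham_vector_field_hamiltonian (m : 'I_N -> R) V q p :
  (forall i, m i != 0) ->
  ham_vector_field (hamiltonian m V) (q, p) =
  (\matrix_i ((m i)^-1 *: row i p), - gradient V q).
Proof.
move=> m0; rewrite /ham_vector_field /hamiltonian /= gradient_kinetic //.
by congr (_, - _); apply/matrixP => i k; rewrite !mxE derive_addl.
Qed.

(** * Derivatives of the mutual distances and of the potential *)

Lemma near_config_space q : config_space q -> \near q, config_space q.
Proof.
move=> cq.
(* One open condition per pair; guarding it by [ij.1 != ij.2] lets [filter_forall] intersect over
   the finite type of all pairs. *)
have near_neq (ij : 'I_N * 'I_N) :
    \forall x \near q, ij.1 != ij.2 -> row ij.1 x != row ij.2 x.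
  have [->|neq] := eqVneq ij.1 ij.2; first by near=> x; rewrite eqxx.
  have /eqP/rowP/existsNP[k /eqP] := cq _ _ neq.
  rewrite !mxE -subr_eq0 => qk.
  have /cvgr_neq0/(_ qk) : (x ij.1 k - x ij.2 k @[x --> q]) -->
    q ij.1 k - q ij.2 k by apply: cvgB; exact: coord_continuous.
  move=> nk; near=> x => _; apply/eqP => /rowP/(_ k); rewrite !mxE.
  by apply/eqP; rewrite -subr_eq0; near: x.
apply: filterS (filter_forall _ near_neq) => x xq i j ij.
exact: (xq (i, j)).
Unshelve. all: by end_near. Qed.

Section MutualDistance.
Variables (i j : 'I_N).

Let sqdist x := dot (row i x - row j x) (row i x - row j x).

Lemma differentiable_sqdist x : differentiable sqdist x.
Proof.
have -> : sqdist = \sum_(k < 3) ((fun x => x i k - x j k) ^+ 2).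
  by apply/funext => y; rewrite fct_sumE; apply: eq_bigr => k _; rewrite !mxE.
apply: differentiable_sum => k; apply: differentiableX.
by apply: differentiableB; exact: differentiable_coord.
Qed.

Lemma differentiable_distance q : row i q != row j q ->
  differentiable (fun x => enorm (row i x - row j x)) q.
Proof.
move=> ij; apply: differentiable_sqrt; first exact: differentiable_sqdist.
by rewrite dot_gt0 subr_eq0.
Qed.

Lemma derive_distance q v : row i q != row j q ->
  'D_v (fun x => enorm (row i x - row j x)) q =
  dot (row i q - row j q) (row i v - row j v) / enorm (row i q - row j q).
Proof.
move=> ij; have d0 : 0 < sqdist q by rewrite dot_gt0 subr_eq0.
rewrite derive_sqrt_comp //; last exact: differentiable_sqdist.
rewrite (@derive_eq_quadratic _ _ _ _ _
  (2 * dot (row i q - row j q) (row i v - row j v))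
  (dot (row i v - row j v) (row i v - row j v))) => [|h].
  by rewrite invfM mulrACA mulVf ?pnatr_eq0 // mul1r mulrC.
rewrite !row_line; set u := row i q - _; set w := row i v - _.
have -> : h *: row i v + row i q - (h *: row j v + row j q) = h *: w + u.
  by rewrite scalerBr opprD addrACA.
exact: dot_line.
Qed.

End MutualDistance.

Lemma ipair_neq (ij : ipair N) : (val ij).1 != (val ij).2.
Proof. by rewrite neq_ltn (valP ij). Qed.

Lemma differentiable_distances q : config_space q ->
  differentiable (@distances R N) q.
Proof.
move=> cq; apply: differentiable_rV => c.
under [X in differentiable X _]funext do rewrite mxE.
exact/differentiable_distance/cq/ipair_neq.
Qed.

Variables (V : 'M[R]_(N, 3) -> R) (D : set 'rV[R]_#|{: ipair N}|).
Variable U : 'rV[R]_#|{: ipair N}| -> R.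
Hypothesis VU : smooth_in_distances V D U.

(** [V] is tied to [U] only on configurations; as these form an open set, both functions have the
    same derivatives there. *)
Lemma near_potential q : config_space q ->
  \near q, V q = (U \o @distances R N) q.
Proof.
move=> cq; have [_ _ _ VE] := VU.
near=> x; apply: VE; near: x; exact: near_config_space.
Unshelve. all: by end_near. Qed.

Lemma differentiable_potential q : config_space q ->
  differentiable (U \o @distances R N) q.
Proof.
move=> cq; have [_ DU sU _] := VU; have [dU _] := sU 1.
apply: differentiable_comp; first exact: differentiable_distances.
exact/dU/DU.
Qed.

(** [gradient] only records partial derivatives; differentiability of [U \o distances] makes the
    derivative linear in [v], hence determined by them. *)
Lemma derive_potential_gradient q v : config_space q ->
  'D_v V q = \sum_i dot (row i v) (row i (gradient V q)).
Proof.
move=> cq; have dW := differentiable_potential cq.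
have DV w : 'D_w V q = 'd (U \o @distances R N) q w.
  by rewrite (near_eq_derive _ (near_potential cq)) deriveE.
rewrite DV [X in 'd _ _ X](matrix_sum_delta v) linear_sum.
apply: eq_bigr => i _; rewrite linear_sum; apply: eq_bigr => k _.
by rewrite linearZ /= !mxE DV.
Qed.

Lemma derive_potential_distances q v : config_space q ->
  'D_v V q = \sum_(ij : ipair N)
    let i := (val ij).1 in let j := (val ij).2 in
    dot (row i q - row j q) (row i v - row j v) / enorm (row i q - row j q)
      * dist_partial U ij (distances q).
Proof.
move=> cq; have [_ DU sU _] := VU; have [dU _] := sU 1.
rewrite (near_eq_derive _ (near_potential cq)) derive_comp_rV; first last.
- exact/dU/DU.
- exact: differentiable_distances.
(* The columns of the distance vector are renamed by the pairs they encode. *)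
rewrite (reindex _ (onW_bij _ (enum_rank_bij _))) /=.
apply: eq_bigr => ij _; rewrite /dist_partial.
under [X in 'D_v X q]funext do rewrite mxE enum_rankK.
by rewrite derive_distance //; exact/cq/ipair_neq.
Qed.

End NBody.

(** * From equal signs to a planar central configuration *)

Lemma same_sign_sum_eq0 (R : realDomainType) (I : finType) (s a : I -> R) :
  (forall i, 0 < a i) \/ (forall i, a i < 0) -> (forall i, 0 <= s i) ->
  \sum_i s i * a i = 0 -> forall i, s i = 0.
Proof.
(* The negative case follows by replacing [a] with its opposite; then a vanishing sum of nonnegative
   terms has only zero terms. *)
move=> sgn s0; wlog a0 : a sgn / forall i, 0 < a i => [ih|sa0 i].
  case: (sgn) => [|a_lt0 sa0]; first exact: ih.
  have Na_gt0 i : 0 < - a i by rewrite oppr_gt0.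
  apply: (ih (fun i => - a i)) => //; first by left.
  by under eq_bigr do rewrite mulrN; rewrite sumrN sa0 oppr0.
have /eqP : s i * a i = 0.
  by apply: (psumr_eq0P _ sa0) => // j _; rewrite mulr_ge0 // ltW.
by rewrite mulf_eq0 [a i == 0]gt_eqF // orbF => /eqP.
Qed.

(** The q-component of the field equality gives p_i = m_i (l x q_i), which is substituted in the
    p-component. For l = 0 the field would vanish. *)
Lemma relative_equilibriumE (R : realType) (N : nat) (m : 'I_N -> R)
    (V : 'M[R]_(N, 3) -> R) (q p : 'M[R]_(N, 3)) :
  (forall i, m i != 0) -> relative_equilibrium m V (q, p) ->
  exists2 l : 'rV[R]_3, l != 0 & forall i,
    row i (gradient V q) = cross (m i *: cross l (row i q)) l.
Proof.
move=> m0 [_ _ _ nz [l HX]]; exists l.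
  apply: contra_notN nz => /eqP l0; rewrite HX ham_vector_field_momentum l0.
  congr (_, _); apply/matrixP => i k.
    by rewrite !mxE !mul0r subr0.
  by rewrite !mxE !mulr0 subr0 oppr0.
move: HX; rewrite ham_vector_field_momentum ham_vector_field_hamiltonian //.
case=> /row_matrixP pE /oppr_inj -> i; rewrite rowK; congr cross.
by have := pE i; rewrite !rowK => <-; rewrite scalerA mulfV // scale1r.
Qed.

Unset Implicit Arguments.

Theorem proposition3p11 (R : realType) (N : nat) (m : 'I_N -> R)
    (V : 'M[R]_(N, 3) -> R) (D : set 'rV[R]_#|{: ipair N}|)
    (U : 'rV[R]_#|{: ipair N}| -> R)
    (N_ge2 : (2 <= N)%N)
    (m_gt0 : forall i, 0 < m i)
    (VU : smooth_in_distances V D U)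
    (equal_signs :
      (forall ij q, config_space q -> 0 < dist_partial U ij (distances q)) \/
      (forall ij q, config_space q -> dist_partial U ij (distances q) < 0))
    (q p : 'M[R]_(N, 3))
    (rel_eq : relative_equilibrium m V (q, p)) :
  central_configuration m V q /\ planar q.
Proof.
have m0 i : m i != 0 by rewrite gt_eqF.
have [cq com0 _ _ _] := rel_eq.
have [l l0 gradE] := relative_equilibriumE m0 rel_eq.
pose a i := dot l (row i q).
have aBE i j : a i - a j = dot l (row i q - row j q) by rewrite dotBr.
have a_eq i j : a i = a j.
  wlog ij : i j / (i < j)%N => [ih|].
    have [->//|] := eqVneq i j.
    by rewrite neq_ltn => /orP[/ih|/ih/esym].
  (* The coefficient of dV/dr_ij in the derivative of [V] along the displacement q_i |-> a_i l. *)
  pose s (c : ipair N) := let i := (val c).1 in let j := (val c).2 in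
    (a i - a j) ^+ 2 / enorm (row i q - row j q).
  have s_eq0 : forall c, s c = 0.
    apply: (@same_sign_sum_eq0 _ _ s (fun c => dist_partial U c (distances q))).
    - by case: equal_signs => U0; [left|right] => c; exact: U0.
    - by move=> c; rewrite divr_ge0 ?sqr_ge0 ?sqrtr_ge0.
    (* That derivative is computed twice: through the distances it is the sum, through the gradient
       each term is a multiple of some l . (w x l) = 0. *)
    transitivity ('D_(\matrix_i (a i *: l)) V q).
      rewrite (derive_potential_distances VU) //; apply: eq_bigr => c _ /=.
      by rewrite /s !rowK -scalerBl dotZr aBE dotC expr2.
    rewrite (derive_potential_gradient VU) //; apply: big1 => k _.
    by rewrite rowK gradE dotC dotZr dotC dot_cross_self mulr0.
  have /eqP := s_eq0 (Sub (i, j) ij).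
  (* Distinct bodies are at positive distance, so it is the numerator of [s] that vanishes. *)
  rewrite /s /= mulf_eq0 sqrf_eq0 subr_eq0 invr_eq0 sqrtr_eq0 leNgt dot_gt0.
  by rewrite subr_eq0 cq ?neq_ltn ?ij // orbF => /eqP.
have lq0 i : dot l (row i q) = 0.
  (* The body [i] makes the sum nonempty. Positivity excludes the default [0^-1 = 0] in the center
     of mass, so the weighted sum of positions is 0. *)
  have M0 : 0 < \sum_j m j.
    by rewrite (bigD1 i) //= ltr_pwDl // sumr_ge0 // => j _; rewrite ltW.
  have /eqP := com0; rewrite scaler_eq0 invr_eq0 gt_eqF //= => /eqP Q0.
  (* As every [a j] equals [a i], pairing [l] with the weighted sum gives the total mass times
     [a i]. *)
  have /eqP : dot l 0 = (\sum_j m j) * dot l (row i q).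
    rewrite -Q0 dot_sumr mulr_suml; apply: eq_bigr => j _.
    by rewrite dotZr -/(a j) (a_eq j i).
  by rewrite dotC dot0l eq_sym mulf_eq0 gt_eqF //= => /eqP.
(* The plane is l . x = 0, and the multiplier of the central configuration is l . l. *)
split; last by exists l, 0; split.
split=> //; exists (dot l l) => i.
by rewrite com0 subr0 gradE cross_crossl lq0 scale0r subr0 scalerA mulrC.
Qed.
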